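(* Let $G$ be a loopless connected graph with a distinguished vertex $v_0$ whose deletion does not disconnect the graph, and let $e_0$ be an edge incident to $v_0$. Suppose that $G$ is $k$-near-cubic ($v_0$ has degree $k$ and every other vertex has degree $3$) of size $n$, i.e. $G$ has $3n+2k-3$ edges. Then there are exactly $2^n$ spanning trees of $G$ containing $e_0$ and such that every edge of $G$ not in the tree joins two comparable vertices.
   Context: Multiple edges are allowed. For a spanning tree $T$ rooted at $v_0$: $u$ is an ancestor of $v$ if $u$ lies on the path in $T$ from $v_0$ to $v$, and $u,v$ are comparable if one is an ancestor of the other. Equivalently, the trees counted are the spanning trees obtainable by a depth-first search of $G$ started at $v_0$ that contain $e_0$. *)

(* Defs.v *)
From HB Require Import structures.
From mathcomp Require Import all_boot.
From mathcomp Require Import boolp.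

Set Implicit Arguments.
Unset Strict Implicit.
Unset Printing Implicit Defensive.

(* [ends e] has one element when [e] is a loop and two otherwise; distinct
   edges may have the same ends. *)
Record multigraph := Multigraph {
  vertex : finType;
  edge : finType;
  ends : edge -> {set vertex};
  ends_card : forall e, 0 < #|ends e| <= 2
}.

Section Multigraph.
Variable G : multigraph.
Implicit Types (u v w : vertex G) (e : edge G).
Implicit Types (T F : {set edge G}) (A : {set vertex G}).

Definition loopless : Prop := forall e, #|ends e| = 2.

Definition joins e u v : bool := ends e == [set u; v].

(* A loop contributes 2 to the degree. *)
Definition degree v : nat :=
  #|[set e | v \in ends e]| + #|[set e | ends e == [set v]]|.

(* A walk is recorded as its list of steps (edge taken, vertex reached). *)
Fixpoint walk F u (p : seq (edge G * vertex G)) v : bool :=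
  if p is (e, w) :: p' then [&& e \in F, joins e u w & walk F w p' v]
  else u == v.

Definition walk_edges (p : seq (edge G * vertex G)) := [seq s.1 | s <- p].
Definition walk_vertices (p : seq (edge G * vertex G)) := [seq s.2 | s <- p].

Definition is_path F u p v : bool :=
  walk F u p v && uniq (u :: walk_vertices p).

(* Requiring distinct edges as well as distinct vertices excludes going back
   and forth along one edge, but keeps the 2-cycles made of parallel edges. *)
Definition is_cycle F u p : bool :=
  [&& p != [::], walk F u p u, uniq (walk_edges p) & uniq (walk_vertices p)].

Definition connected_on A F : Prop :=
  forall u v, u \in A -> v \in A -> exists p, walk F u p v.

Definition connected : Prop := connected_on [set: vertex G] [set: edge G].

Definition connected_without v0 : Prop :=
  connected_on [set~ v0] [set e | v0 \notin ends e].

Definition acyclic F : Prop := forall u p, ~~ is_cycle F u p.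

Definition spanning_tree T : Prop :=
  connected_on [set: vertex G] T /\ acyclic T.

Definition ancestor v0 T u v : Prop :=
  exists p, is_path T v0 p v /\ u \in v0 :: walk_vertices p.

Definition tree_comparable v0 T u v : Prop :=
  ancestor v0 T u v \/ ancestor v0 T v u.

Definition near_cubic v0 (k : nat) : Prop :=
  degree v0 = k /\ forall v, v != v0 -> degree v = 3.

(* #|E| = 3n + 2k - 3, written without truncated subtraction. *)
Definition near_cubic_size (k n : nat) : Prop :=
  #|edge G| + 3 = 3 * n + 2 * k.

Definition externals_comparable v0 T : Prop :=
  forall e u v, e \notin T -> joins e u v -> tree_comparable v0 T u v.

End Multigraph.

(* Main.v *)
Require Import Defs.
From mathcomp Require Import all_boot.
From mathcomp Require Import boolp zify.

(** Explore [G] depth first from [v0], and let [S] be the set of unvisited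
    vertices.  Every component of the graph induced on [S] contains exactly one
    vertex already attached to the tree; call it the root of the component.
    Visiting a root [r] means choosing, for each component of [S :\ r] adjacent
    to [r], exactly one edge from [r] to it: at least one because the tree is
    spanning, at most one because vertices below distinct children of [r] are
    incomparable.  As [r] has at most two edges inside [S], the sum of
    [2 ^ #|A|] over the admissible choices [A] is [2] to the number of those
    edges, whence by induction on [S] the number of completions is [2] to the
    cyclomatic number (edges - vertices + components) of the graph on [S].
    Since [G - v0] is connected, [e0] is the only tree edge at [v0], and the
    cyclomatic number of [G - v0] is [n] by the handshake lemma. *)

Set Implicit Arguments.
Unset Strict Implicit.
Unset Printing Implicit Defensive.

(** * Walks, paths and cycles *)

Section Walks.
Variable G : multigraph.
Implicit Types (u v w x : vertex G) (e f : edge G) (T F : {set edge G}).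
Implicit Types (p q : seq (edge G * vertex G)).

Lemma joinsC e u v : joins e u v = joins e v u.
Proof. by rewrite /joins setUC. Qed.

Lemma joinsE e u v x : joins e u v -> (x \in ends e) = (x == u) || (x == v).
Proof. by move=> /eqP->; rewrite !inE. Qed.

Lemma joinsl e u v : joins e u v -> u \in ends e.
Proof. by move=> /joinsE->; rewrite eqxx. Qed.

Lemma joinsr e u v : joins e u v -> v \in ends e.
Proof. by move=> /joinsE->; rewrite eqxx orbT. Qed.

Lemma joins_inj e u v w : joins e u v -> joins e u w -> v = w.
Proof.
move=> euv euw; have := joinsr euv; rewrite (joinsE _ euw).
have := joinsr euw; rewrite (joinsE _ euv).
by do 2![case/orP=> /eqP ?]; congruence.
Qed.

Lemma walk_last F u p v : walk F u p v -> last u (walk_vertices p) = v.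
Proof.
elim: p u => [|[e w] p IH] u /=; first by move/eqP.
by case/and3P=> _ _ /IH.
Qed.

Lemma walk_cat F u p q v :
  walk F u (p ++ q) v =
  walk F u p (last u (walk_vertices p)) && walk F (last u (walk_vertices p)) q v.
Proof. by elim: p u => [|[e w] p IH] u /=; rewrite ?eqxx // IH !andbA. Qed.

Lemma walk_vertices_cat p q :
  walk_vertices (p ++ q) = walk_vertices p ++ walk_vertices q.
Proof. exact: map_cat. Qed.

Lemma walkS F F' u p v : F \subset F' -> walk F u p v -> walk F' u p v.
Proof.
move=> /subsetP sFF'; elim: p u => [|[e w] p IH] u //=.
by case/and3P=> /sFF'-> -> /IH.
Qed.

Lemma walk_restrict F F' u p v :
  walk F u p v -> {subset walk_edges p <= F'} -> walk F' u p v.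
Proof.
elim: p u => [|[e w] p IH] u //= /and3P[_ -> pw] sub; rewrite sub ?mem_head //=.
by apply: IH => // f fp; apply: sub; rewrite inE fp orbT.
Qed.

Lemma walk_edges_sub F u p v : walk F u p v -> {subset walk_edges p <= F}.
Proof.
elim: p u => [|[e w] p IH] u //= /and3P[eF _ /IH sub] f.
by rewrite inE => /orP[/eqP->|/sub].
Qed.

Lemma walk_ends F u p v e x :
  walk F u p v -> e \in walk_edges p -> x \in ends e ->
  x \in u :: walk_vertices p.
Proof.
elim: p u => [|[f w] p IH] u //= /and3P[_ fuw pw]; rewrite inE.
case/orP=> [/eqP->|ep xe]; last by rewrite inE (IH w) ?orbT.
by rewrite (joinsE _ fuw) !inE orbA => ->.
Qed.

Lemma walk_vertex_edge F u p v x :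
  walk F u p v -> x \in walk_vertices p -> exists2 e, e \in F & x \in ends e.
Proof.
elim: p u => [|[e w] p IH] u //= /and3P[eF euw pw].
rewrite inE => /orP[/eqP->|/(IH w pw) //].
by exists e => //; apply: joinsr euw.
Qed.

Lemma walk_split F u p v x :
  walk F u p v -> x \in u :: walk_vertices p ->
  exists p1 p2, [/\ p = p1 ++ p2, walk F u p1 x & walk F x p2 v].
Proof.
elim: p u => [|[e w] p IH] u.
  by move=> puv; rewrite !inE => /eqP->; exists [::], [::]; rewrite /= eqxx.
rewrite inE; have [->|_] := eqVneq x u => puv.
  by exists [::], ((e, w) :: p); rewrite /= eqxx.
move: puv => /= /and3P[eF euw pwv] xp.
have [p1 [p2 [-> p1x p2v]]] := IH w pwv xp.
by exists ((e, w) :: p1), p2; split=> //=; rewrite eF euw.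
Qed.

Lemma walk_rev F u p v : walk F u p v ->
  exists2 q, walk F v q u & {subset v :: walk_vertices q <= u :: walk_vertices p}.
Proof.
elim: p u => [|[e w] p IH] u /=.
  by move=> /eqP->; exists [::] => //=.
case/and3P=> eF euw pwv; have [q qvw sub] := IH w pwv.
exists (q ++ [:: (e, u)]).
  by rewrite walk_cat (walk_last qvw) qvw /= eF joinsC euw eqxx.
move=> x; rewrite walk_vertices_cat -cat_cons mem_cat => /orP[/sub xp|].
  by rewrite inE xp orbT.
by rewrite !inE => ->.
Qed.

Lemma is_path_split F u p v x :
  is_path F u p v -> x \in u :: walk_vertices p ->
  exists p1 p2, [/\ p = p1 ++ p2, is_path F u p1 x & is_path F x p2 v].
Proof.
case/andP=> puv up xp; have [p1 [p2 [pE p1x p2v]]] := walk_split puv xp.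
exists p1, p2; split=> //; rewrite /is_path ?p1x ?p2v /=.
  by move: up; rewrite pE walk_vertices_cat -cat_cons cat_uniq => /andP[].
move: up; rewrite pE walk_vertices_cat -cat_cons lastI (walk_last p1x).
by rewrite cat_rcons cat_uniq => /and3P[].
Qed.

(** By induction on the walk: when the start recurs on the path built from the second vertex, only
    the part after that occurrence is kept. *)
Lemma walk_path F u p v : walk F u p v ->
  exists2 q, is_path F u q v & {subset walk_vertices q <= walk_vertices p}.
Proof.
elim: p u => [|[e w] p IH] u /=.
  by move=> uv; exists [::] => //; rewrite /is_path /= uv.
case/and3P=> eF euw pwv; have [q qP sub] := IH w pwv.
have sub' : {subset w :: walk_vertices q <= w :: walk_vertices p}.
  by move=> x; rewrite !inE => /orP[->//|/sub->]; rewrite orbT.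
have [uq|uq] := boolP (u \in w :: walk_vertices q); last first.
  exists ((e, w) :: q) => //.
  by move: qP; rewrite /is_path /= uq eF euw => /andP[-> ->].
have [q1 [q2 [qE _ q2P]]] := is_path_split qP uq.
exists q2 => // x xq2; apply: sub'.
by rewrite qE walk_vertices_cat inE mem_cat xq2 !orbT.
Qed.

Lemma is_path_uniq_edges F u p v : is_path F u p v -> uniq (walk_edges p).
Proof.
case/andP; elim: p u => [|[e w] p IH] u //= /and3P[eF euw pwv].
case/andP=> up /(IH w pwv)->.
rewrite andbT; apply: contra up => ep.
exact: walk_ends pwv ep (joinsl euw).
Qed.

(* A walk from [a] to [b] avoiding [u] closes up into a cycle through [u]
   unless the two edges at [u] coincide. *)
Lemma acyclic_closing F u a b e f p :
  acyclic F -> e \in F -> f \in F -> joins e u a -> joins f u b ->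
  walk F a p b -> u \notin a :: walk_vertices p -> e = f.
Proof.
move=> acF eF fF eua fub /walk_path[q qP sub] up; apply/eqP/negPn/negP => ef.
have uq : u \notin a :: walk_vertices q.
  by apply: contra up; rewrite !inE => /orP[->//|/sub->]; rewrite orbT.
have qab : walk F a q b by case/andP: (qP).
suff: is_cycle F u ((e, a) :: q ++ [:: (f, u)]) by apply/negP; apply: acF.
have Nq g : u \in ends g -> g \notin walk_edges q.
  by move=> ug; apply: contra uq => gq; apply: walk_ends qab gq ug.
have uv : uniq (walk_vertices ((e, a) :: q ++ [:: (f, u)])).
  by rewrite -cat_cons walk_vertices_cat cats1 rcons_uniq uq; case/andP: qP.
rewrite /is_cycle uv andbT /= eF eua walk_cat (walk_last qab) qab /= fF joinsC fub eqxx /=.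
rewrite /walk_edges map_cat mem_cat cat_uniq /= orbF !inE (negPf ef) orbF andbT.
by rewrite (is_path_uniq_edges qP) (Nq e) ?(joinsl eua) // (Nq f) ?(joinsl fub).
Qed.

(** If the first edges differed, one tail followed by the reverse of the other would be a walk
    avoiding [u], which [acyclic_closing] forbids. So the first steps agree, and induction handles
    the tails. *)
Lemma is_path_unique F u p q v :
  acyclic F -> is_path F u p v -> is_path F u q v -> p = q.
Proof.
move=> acF; elim: p u q => [|[e a] p IH] u [|[f b] q] //.
- case/andP=> /= /eqP-> _ /andP[/= /and3P[_ _ q1] /andP[+ _]].
  by rewrite -{1}(walk_last q1) mem_last.
- case/andP=> /= /and3P[_ _ p1] /andP[+ _] /andP[/= /eqP uv _].
  by rewrite uv -{1}(walk_last p1) mem_last.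
case/andP=> /= /and3P[eF eua pav] /andP[up pu] /andP[/= /and3P[fF fub qbv] /andP[uq qu]].
have [r rvb subr] := walk_rev qbv.
have ef : e = f.
  apply: (@acyclic_closing F u a b e f (p ++ r)) => //.
    by rewrite walk_cat (walk_last pav) pav.
  rewrite walk_vertices_cat -cat_cons mem_cat negb_or up.
  by apply: contra uq => ur; apply: subr; rewrite inE ur orbT.
have ab : a = b by apply: (joins_inj eua); rewrite ef.
rewrite ef -ab (IH a q) // /is_path ?pav //.
by rewrite ab qbv.
Qed.

Lemma is_path_prefix F u p q v :
  is_path F u (p ++ q) v -> is_path F u p (last u (walk_vertices p)).
Proof.
case/andP; rewrite walk_cat /is_path => /andP[-> _].
by rewrite walk_vertices_cat -cat_cons cat_uniq => /andP[].
Qed.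

Lemma ancestorS F F' v0 u v : F \subset F' -> ancestor v0 F u v -> ancestor v0 F' u v.
Proof.
move=> sub [p [/andP[pv up] xp]]; exists p; split=> //.
by rewrite /is_path (walkS sub pv).
Qed.

Lemma tree_comparableS F F' v0 u v :
  F \subset F' -> tree_comparable v0 F u v -> tree_comparable v0 F' u v.
Proof. by move=> sub [] /(ancestorS sub); [left | right]. Qed.

Lemma is_path_rcons F u p v e w :
  is_path F u p v -> e \in F -> joins e v w -> w \notin u :: walk_vertices p ->
  is_path F u (rcons p (e, w)) w.
Proof.
case/andP=> puv up eF evw wp.
rewrite /is_path -cats1 walk_vertices_cat -cat_cons (cats1 _ w) rcons_uniq wp up andbT.
by rewrite walk_cat (walk_last puv) puv /= eF evw eqxx.
Qed.

End Walks.

(** * Loopless graphs: cycles avoid pendant edges *)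

Section Loopless.
Variable G : multigraph.
Hypothesis Gll : loopless G.
Implicit Types (u v w x : vertex G) (e f : edge G) (T F : {set edge G}).

Lemma joins_neq e u v : joins e u v -> u != v.
Proof.
by move=> /eqP euv; have := Gll e; rewrite euv cards2; case: eqVneq.
Qed.

Lemma joins_other e u : u \in ends e -> exists v, joins e u v.
Proof.
have /eqP/cards2P[x [y [xy exy]]] := Gll e.
rewrite exy !inE => /orP[] /eqP->; first by exists y; rewrite /joins exy.
by exists x; rewrite joinsC /joins exy.
Qed.

Lemma walk_leaf_edge F u p w e :
  (forall f, f \in F -> w \in ends f -> f = e) ->
  walk F u p w -> u != w -> e \in walk_edges p.
Proof.
move=> leaf; elim: p u => [|[f x] p IH] u /=; first by move=> /eqP->; rewrite eqxx.
case/and3P=> fF fux pxw uw; rewrite inE.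
have [xw|/(IH x pxw)->] := eqVneq x w; last by rewrite orbT.
by rewrite (leaf f) ?eqxx // -xw (joinsr fux).
Qed.

(** Passing through the leaf [w] would mean entering and leaving it by the same edge [e], against
    the distinctness of the edges. *)
Lemma walk_avoid_leaf F u p v w e :
  e \in F -> w \in ends e -> (forall f, f \in F -> w \in ends f -> f = e) ->
  walk F u p v -> uniq (walk_edges p) -> u != w -> v != w ->
  e \notin walk_edges p.
Proof.
move=> eF we leaf; elim: p u => [|[f x] p IH] u //=.
case/and3P=> fF fux pxv /andP[fp pu] uw vw; rewrite inE negb_or.
have [xw|xw] := eqVneq x w; last first.
  rewrite (IH x) // andbT; apply/eqP=> ef; move: we; rewrite ef (joinsE _ fux).
  by rewrite eq_sym (negPf uw) eq_sym (negPf xw).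
have fe : f = e by apply: leaf => //; rewrite -xw (joinsr fux).
case: p {IH pu} pxv fp => [|[g y] p] /=.
  by move=> /eqP xv; rewrite -xv xw eqxx in vw.
case/and3P=> gF gxy _; rewrite inE (leaf g) // -?fe ?eqxx //.
by rewrite -xw (joinsl gxy).
Qed.

Lemma cycle_avoid_leaf F u p w e :
  e \in F -> w \in ends e -> (forall f, f \in F -> w \in ends f -> f = e) ->
  is_cycle F u p -> e \notin walk_edges p.
Proof.
move=> eF we leaf /and4P[p0 puu ue uv].
have [uw|uw] := eqVneq u w; last exact: (walk_avoid_leaf eF we leaf puu ue uw uw).
move: uw p0 puu ue => -> {u uv}; case: p => [|[f x] p] //= _.
case/and3P=> fF fwx pxw /andP[fp up].
have fe : f = e by apply: leaf => //; apply: joinsl fwx.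
(* A cycle based at the leaf itself starts with [e] and must use [e] again to return. *)
by move: fp; rewrite fe (walk_leaf_edge leaf pxw) // eq_sym (joins_neq fwx).
Qed.

End Loopless.

(** * Components of induced subgraphs *)

Section Components.
Variable G : multigraph.
Implicit Types (u v w x r s : vertex G) (e f : edge G).
Implicit Types (S : {set vertex G}) (A : {set edge G}).

Definition adjacent_in S : rel (vertex G) :=
  [rel u v | [&& u \in S, v \in S & [exists e, joins e u v]]].

(** Being in the same component of the graph induced on [S]; a vertex outside [S] is linked only to
    itself. *)
Definition linked S : rel (vertex G) := connect (adjacent_in S).

Definition inside S : {set edge G} := [set e | ends e \subset S].

Definition star S r : {set edge G} := [set e in inside S | r \in ends e].

Definition same_branch S r e f : bool :=
  [exists u, exists v, [&& joins e r u, joins f r v & linked (S :\ r) u v]].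

(** The admissible choices at [r]: transversals of the relation [same_branch] on the edges from [r]
    into [S]. *)
Definition branching S r A : bool :=
  [&& A \subset star S r,
      [forall f in star S r, exists e in A, same_branch S r e f] &
      [forall e in A, forall f in A, same_branch S r e f ==> (e == f)]].

Lemma linked_sym S u v : linked S u v = linked S v u.
Proof.
apply: (sym_connect_sym (e := adjacent_in S)) => {u v} u v; rewrite /adjacent_in /= andbCA.
by congr [&& _, _ & _]; apply: eq_existsb => e; rewrite joinsC.
Qed.

Lemma linked_trans S u v w : linked S u v -> linked S v w -> linked S u w.
Proof. exact: connect_trans. Qed.

Lemma linkedS S S' u v : S \subset S' -> linked S u v -> linked S' u v.
Proof.
move=> /subsetP sub; apply: connect_sub => {u v} u v /= /and3P[/sub uS /sub vS uv].
by apply: connect1; rewrite /adjacent_in /= uS vS.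
Qed.

Lemma joins_linked S e u v : u \in S -> v \in S -> joins e u v -> linked S u v.
Proof.
by move=> uS vS euv; apply: connect1; rewrite /adjacent_in /= uS vS; apply/existsP; exists e.
Qed.

Lemma linked_ind S v (Q : vertex G -> Prop) :
    Q v ->
    (forall u w e, u \in S -> w \in S -> joins e u w -> linked S w v -> Q w -> Q u) ->
  forall u, linked S u v -> Q u.
Proof.
move=> Q0 QS u /connectP[p]; elim: p u => [|w p IH] u /=; first by move=> _ <-.
case/andP=> /and3P[uS wS /existsP[e euw]] pw pv.
by apply: (QS u w e) => //; [apply/connectP; exists p | apply: IH].
Qed.

Lemma linked_mem S u v : linked S u v -> v \in S -> u \in S.
Proof. by move=> uv vS; move: u uv; apply: linked_ind. Qed.

(** A path inside [S] ending at [s] cannot meet [r], since [r] lies in another component. *)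
Lemma linked_avoid S r u s :
  linked S u s -> ~~ linked S r s -> linked (S :\ r) u s.
Proof.
move=> us rs; move: u us; apply: linked_ind => [|u w e uS wS euw ws IH].
  exact: connect0.
apply: linked_trans IH; apply: (@joins_linked _ e) => //; rewrite !inE.
  rewrite uS andbT; apply: contra rs => /eqP<-.
  by apply: linked_trans ws; apply: joins_linked euw.
by rewrite wS andbT; apply: contra rs => /eqP<-.
Qed.

Lemma star_joins S r e w : joins e r w -> (e \in star S r) = (r \in S) && (w \in S).
Proof. by move=> /eqP erw; rewrite !inE erw subUset !sub1set !inE eqxx andbT. Qed.

Lemma linked_branch S r s : linked S r s -> s \in S -> s != r ->
  exists e w, [/\ e \in star S r, joins e r w & linked (S :\ r) w s].
Proof.
move=> rs sS sr; have rS := linked_mem rs sS.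
(* The disjunction is proved for every starting vertex linked to [s]: either [r] can be avoided, or
   some edge leaves [r] for the branch of [s]. Starting at [r], the first case is absurd. *)
suff: (r \in S :\ r /\ linked (S :\ r) r s) \/
  exists e w, [/\ e \in star S r, joins e r w & linked (S :\ r) w s].
  by case=> // -[]; rewrite !inE eqxx.
move: {1 2 5}r rs; apply: linked_ind => [|u w e uS wS euw _ [[wSr IH]|]].
- by left; rewrite !inE sr sS; split=> //; apply: connect0.
- have [ur|ur] := eqVneq u r.
    move: euw uS; rewrite ur => erw _.
    by right; exists e, w; rewrite (star_joins _ erw) rS wS.
  have uSr : u \in S :\ r by rewrite !inE ur.
  by left; split=> //; apply: linked_trans IH; apply: joins_linked euw.
- by right.
Qed.

Lemma same_branch_joins S r e f u v :
  joins e r u -> joins f r v -> same_branch S r e f = linked (S :\ r) u v.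
Proof.
move=> eru frv; apply/existsP/idP=> [[x /existsP[y /and3P[erx fry]]]|uv].
  by rewrite (joins_inj eru erx) (joins_inj frv fry).
by exists u; apply/existsP; exists v; rewrite eru frv.
Qed.

Lemma branchingP S r A : reflect
  [/\ A \subset star S r,
      forall f, f \in star S r -> exists2 e, e \in A & same_branch S r e f &
      forall e f, e \in A -> f \in A -> same_branch S r e f -> e = f]
  (branching S r A).
Proof.
apply: (iffP and3P) => -[sA ex un]; split=> //.
- by move=> f fS; have /exists_inP := forall_inP ex f fS.
- by move=> e f eA fA ef; have /forall_inP/(_ f fA)/implyP/(_ ef)/eqP := forall_inP un e eA.
- by apply/forall_inP=> f fS; apply/exists_inP; apply: ex.
- apply/forall_inP=> e eA; apply/forall_inP=> f fA; apply/implyP=> ef.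
  by apply/eqP; apply: un.
Qed.

End Components.

(** * States of a depth-first search *)

Section States.
Variable G : multigraph.
Hypothesis Gll : loopless G.
Variable v0 : vertex G.
Implicit Types (u v w x r s : vertex G) (e f : edge G).
Implicit Types (S R : {set vertex G}) (A P T : {set edge G}).

Definition dfs_tree T : Prop := spanning_tree T /\ externals_comparable v0 T.

(** The vertex set of the partial tree: visited vertices and pending roots. *)
Definition reached S R : {set vertex G} := ~: S :|: R.

(* [S] is the set of unvisited vertices, [P] the set of tree edges chosen so far
   (all those of the final tree that are not inside [S]) and [R] the set of
   unvisited vertices already attached by [P]; [st_ancestor] is what makes the
   edges between visited and unvisited vertices comparable in the end. *)
Record dfs_state S P R : Prop := DfsState {
  st_roots : R \subset S;
  st_v0 : v0 \in reached S R;
  st_outside : forall e, e \in P -> e \notin inside S;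
  st_ends : forall e x, e \in P -> x \in ends e -> x \in reached S R;
  st_acyclic : acyclic P;
  st_path : forall v, v \in reached S R -> exists p, is_path P v0 p v;
  st_root_ex : forall s, s \in S -> exists2 r, r \in R & linked S r s;
  st_root_uniq : forall r r', r \in R -> r' \in R -> linked S r r' -> r = r';
  st_comparable : forall e u v, e \notin P -> joins e u v ->
    u \notin S -> v \notin S -> tree_comparable v0 P u v;
  st_ancestor : forall e x s r, joins e x s -> x \notin S -> s \in S ->
    r \in R -> linked S r s -> ancestor v0 P x r
}.

Lemma notin_reached S R u : (u \notin reached S R) = (u \in S) && (u \notin R).
Proof. by rewrite !inE negb_or negbK. Qed.

Section Step.
Variables (S R : {set vertex G}) (P : {set edge G}) (r : vertex G).
Hypotheses (st : dfs_state S P R) (rR : r \in R).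

Let rS : r \in S. Proof. exact: (subsetP (st_roots st)). Qed.

Lemma linked_root s : s \in S -> linked S r s -> s != r -> s \notin reached S R.
Proof.
move=> sS rs sr; rewrite notin_reached sS; apply: contra sr => sR.
by rewrite (st_root_uniq st rR sR rs).
Qed.

Lemma walk_reached p v :
  walk P v0 p v -> {subset v0 :: walk_vertices p <= reached S R}.
Proof.
move=> pv x; rewrite inE => /orP[/eqP->|xp]; first exact: st_v0 st.
by have [e eP xe] := walk_vertex_edge pv xp; apply: st_ends eP xe.
Qed.

Lemma star_other e w : e \in star S r -> joins e r w ->
  [/\ w \in S, w != r, linked S r w & w \notin reached S R].
Proof.
move=> eS erw; move: eS; rewrite (star_joins _ erw) => /andP[_ wS].
have wr : w != r by rewrite eq_sym (joins_neq Gll erw).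
have rw := joins_linked rS wS erw.
by split=> //; apply: linked_root.
Qed.

(** * Every depth-first tree induces a branching at each root *)

Section Backward.
Variable T : {set edge G}.
Hypotheses (dT : dfs_tree T) (TP : T :\: inside S = P).

Let subPT : P \subset T. Proof. by rewrite -TP subsetDl. Qed.

(** The walk is read backwards from [c]: it stays in the branch of [c] until it crosses an edge at
    [r]. Applied to a walk from [v0], which is reached, only the first alternative survives. *)
Lemma walk_enters_branch u q c :
    walk T u q c -> c \in S -> c != r -> linked S r c ->
  (exists e w, [/\ e \in T, e \in star S r, joins e r w & linked (S :\ r) w c])
  \/ (u \notin reached S R /\ linked (S :\ r) u c).
Proof.
move=> + cS cr rc; elim: q u => [|[e w] q IH] u /=.
  by move=> /eqP->; right; split; [apply: linked_root | apply: connect0].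
case/and3P=> eT euw /IH[]; [by left | case=> wR wc].
have wS : w \in S by move: wR; rewrite notin_reached => /andP[].
have wr : w != r by apply: contraNneq wR => ->; rewrite !inE rR orbT.
have [uS|uS] := boolP (u \in S); last first.
  (* An edge of [T] leaving [S] already belongs to [P], so both its ends are reached, unlike [w]. *)
  have eP : e \in P.
    by rewrite -TP !inE eT andbT; apply: contra uS => /subsetP; apply; apply: joinsl euw.
  by rewrite (st_ends st eP (joinsr euw)) in wR.
have [ur|ur] := eqVneq u r.
  move: euw; rewrite ur => erw.
  by left; exists e, w; rewrite (star_joins _ erw) rS wS.
have uSr : u \in S :\ r by rewrite !inE ur.
have wSr : w \in S :\ r by rewrite !inE wr.
have uc : linked (S :\ r) u c.
  by apply: linked_trans wc; apply: joins_linked euw.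
right; split=> //; apply: linked_root => //.
by apply: (linked_trans rc); rewrite linked_sym; apply: linkedS uc; apply: subD1set.
Qed.

(* Comparability with respect to [T] propagates "reached through [e]" along the
   edges of a component of [S :\ r], so a component cannot be entered twice. *)
Lemma tree_branch_uniq e f :
  e \in T -> f \in T -> e \in star S r -> f \in star S r ->
  same_branch S r e f -> e = f.
Proof.
move=> eT fT eS fS /existsP[a /existsP[b /and3P[era frb ab]]].
have [[conT acT] cmpT] := dT.
have [pr prP] : exists p, is_path P v0 p r.
  by apply: (st_path st); rewrite !inE rR orbT.
have prT : is_path T v0 pr r.
  by case/andP: prP => prr up; rewrite /is_path (walkS subPT prr).
have pr_reached := walk_reached (proj1 (andP prP)).
have [aS ar ra aN] := star_other eS era.
have [bS br rb bN] := star_other fS frb.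
have pathT g c : g \in T -> joins g r c -> c \notin reached S R ->
    is_path T v0 (rcons pr (g, c)) c.
  move=> gT grc cN; apply: is_path_rcons prT gT grc _.
  by apply: contra cN => /pr_reached.
(* The tree path to [s] goes to [r] and continues by [e]. For [s = b] it must also continue by [f],
   so uniqueness of tree paths gives [e = f]. *)
pose through s := exists q, is_path T v0 (rcons pr (e, a) ++ q) s.
suff [q qb] : through b.
  have := is_path_unique acT qb (pathT f b fT frb bN).
  rewrite -!cats1 -catA => /eqP; rewrite eqseq_cat // eqxx /= => /eqP.
  by case.
have ba : linked (S :\ r) b a by rewrite linked_sym.
move: b ba {ab frb bS br rb bN}.
apply: linked_ind => [|u s g uS sS gus sa [q qs]].
  by exists [::]; rewrite cats0; apply: pathT.
have uN : u \notin reached S R.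
  have /setD1P[ur {}uS] := uS.
  have us : linked S u s by apply: joins_linked gus => //; case/setD1P: sS.
  have sa' : linked S s a by apply: linkedS sa; apply: subD1set.
  apply: linked_root => //; apply: (linked_trans ra).
  by rewrite linked_sym; apply: linked_trans sa'.
(* The vertex [u] is not reached, so it is not on the path to [r]; if it lies on the path to [s], it
   comes after [e]. *)
have prefix p : is_path T v0 p s -> u \in v0 :: walk_vertices p -> through u.
  move=> pP; rewrite (is_path_unique acT pP qs) => up.
  have {up}uq : u \in a :: walk_vertices q.
    move: up; rewrite -cats1 -catA walk_vertices_cat -cat_cons mem_cat.
    case/orP=> [/pr_reached|//].
    by rewrite (negPf uN).
  have /andP[ea _] := pathT e a eT era aN.
  have /andP[+ _] := qs; rewrite walk_cat (walk_last ea) => /andP[_ qs2].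
  have [q1 [q2 [qE q1u _]]] := walk_split qs2 uq.
  have := qs; rewrite qE catA => /is_path_prefix.
  by rewrite walk_vertices_cat last_cat (walk_last ea) (walk_last q1u); exists q1.
have [gT|gT] := boolP (g \in T).
  have [up|up] := boolP (u \in v0 :: walk_vertices (rcons pr (e, a) ++ q)).
    exact: prefix up.
  exists (rcons q (g, u)); rewrite -rcons_cat.
  by apply: is_path_rcons qs gT _ up; rewrite joinsC.
have [[p [pP up]]|[p [pP sp]]] := cmpT g u s gT gus; first exact: prefix up.
(* Here [s] is an ancestor of [u], so the path to [u] extends the path to [s]. *)
have [p1 [p2 [pE p1P _]]] := is_path_split pP sp.
by exists (q ++ p2); rewrite catA -(is_path_unique acT p1P qs) -pE.
Qed.

Lemma tree_branching : branching S r (T :&: star S r).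
Proof.
have [[conT _] _] := dT.
apply/branchingP; split=> [|f fS|e f]; first exact: subsetIr.
  have rf : r \in ends f by move: fS; rewrite inE => /andP[].
  have [c frc] := joins_other Gll rf.
  have [cS cr rc cN] := star_other fS frc.
  have [q qc] := conT v0 c (in_setT _) (in_setT _).
  have [[e [w [eT eS erw wc]]]|[v0N _]] := walk_enters_branch qc cS cr rc.
    by exists e; [rewrite in_setI eT | rewrite (same_branch_joins _ erw frc)].
  by rewrite (st_v0 st) in v0N.
case/setIP=> eT eS /setIP[fT fS]; exact: tree_branch_uniq.
Qed.

End Backward.
End Step.
End States.

(** * Counting *)

Lemma setU_inj (U : finType) (I X Y X' Y' : {set U}) :
  [disjoint X & I] -> Y \subset I -> [disjoint X' & I] -> Y' \subset I ->
  X :|: Y = X' :|: Y' -> X = X' /\ Y = Y'.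
Proof.
have split (Z W : {set U}) : [disjoint Z & I] -> W \subset I ->
    (Z :|: W) :\: I = Z /\ (Z :|: W) :&: I = W.
  move=> ZI WI; rewrite setDUl setIUl (setDidPl ZI) (setIidPl WI).
  have /eqP-> : W :\: I == set0 by rewrite setD_eq0.
  by move: ZI; rewrite -setI_eq0 => /eqP->; rewrite setU0 set0U.
move=> XI YI XI' YI' E.
have [[X1 Y1] [X2 Y2]] := (split X Y XI YI, split X' Y' XI' YI').
by split; [rewrite -X1 E X2 | rewrite -Y1 E Y2].
Qed.

Section Count.
Variable G : multigraph.
Hypothesis Gll : loopless G.
Variable v0 : vertex G.
Implicit Types (u v w x r s : vertex G) (e f : edge G).
Implicit Types (S R : {set vertex G}) (A P T : {set edge G}).

Definition other_end r e : vertex G := odflt r [pick w | joins e r w].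

Lemma joins_other_end r e : r \in ends e -> joins e r (other_end r e).
Proof.
rewrite /other_end => /(joins_other Gll)[w erw]; case: pickP => [x //|/(_ w)].
by rewrite erw.
Qed.

Lemma star_mem S r e : e \in star S r -> r \in ends e.
Proof. by rewrite inE => /andP[]. Qed.

Lemma same_branch_refl S r e : e \in star S r -> same_branch S r e e.
Proof.
move=> /star_mem/joins_other_end er; rewrite (same_branch_joins _ er er).
exact: connect0.
Qed.

Lemma same_branch_sym S r e f : same_branch S r e f = same_branch S r f e.
Proof.
by apply/existsP/existsP=> -[u /existsP[v /and3P[eu fv uv]]];
  exists v; apply/existsP; exists u; rewrite eu fv linked_sym.
Qed.

Definition new_roots r A : {set vertex G} := [set other_end r e | e in A].

Lemma new_rootsP S r A w : A \subset star S r ->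
  reflect (exists2 e, e \in A & joins e r w) (w \in new_roots r A).
Proof.
move=> /subsetP AS; apply: (iffP imsetP) => -[e eA].
  by move=> ->; exists e => //; apply/joins_other_end/star_mem/AS.
move=> erw; exists e => //; apply: (joins_inj erw).
exact: joins_other_end (joinsl erw).
Qed.

Lemma card_new_roots S r A : branching S r A -> #|new_roots r A| = #|A|.
Proof.
case/branchingP=> /subsetP AS _ un; apply: card_in_imset => e f eA fA ef.
apply: un => //.
have er := joins_other_end (star_mem (AS e eA)).
have fr := joins_other_end (star_mem (AS f fA)).
by rewrite (same_branch_joins _ er fr) ef; apply: connect0.
Qed.

Lemma branching_one S r A :
    (forall e f, e \in star S r -> f \in star S r -> same_branch S r e f) ->
    star S r != set0 ->
  branching S r A = (A \in [set [set e] | e in star S r]).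
Proof.
move=> rel /set0Pn[b bS]; apply/branchingP/imsetP=> [[AS ex un]|[e eS ->]].
  have [e eA _] := ex b bS; exists e; first exact: (subsetP AS).
  apply/setP=> f; rewrite inE; apply/idP/eqP=> [fA|-> //].
  by apply: un => //; apply: rel; apply: (subsetP AS).
split; first by rewrite sub1set.
  by move=> f fS; exists e; rewrite ?inE //; apply: rel.
by move=> f g; rewrite !inE => /eqP-> /eqP->.
Qed.

Lemma branching_all S r A :
    {in star S r &, forall e f, same_branch S r e f -> e = f} ->
  branching S r A = (A == star S r).
Proof.
move=> inj; apply/branchingP/eqP=> [[AS ex un]|->].
  apply/eqP; rewrite eqEsubset AS; apply/subsetP=> f fS.
  by have [e eA /inj<- //] := ex f fS; apply: (subsetP AS).
by split=> // f fS; exists f => //; apply: same_branch_refl.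
Qed.

(** Two distinct edges into one branch give two singleton choices, with sum 2 + 2 = 4. Otherwise all
    edges lead to different branches and the whole star is the only choice. *)
Lemma sum_branching S r : #|star S r| <= 2 ->
  \sum_(A | branching S r A) 2 ^ #|A| = 2 ^ #|star S r|.
Proof.
move=> le2.
have [/existsP[b /existsP[c /and4P[bS cS bc bcS]]]|noPair] := boolP
  [exists b, exists c, [&& b \in star S r, c \in star S r, b != c & same_branch S r b c]].
  have starE : star S r = [set b; c].
    apply/esym/eqP; rewrite eqEcard cards2 bc le2 andbT.
    by apply/subsetP=> x /set2P[] ->.
  rewrite (eq_bigl (mem [set [set e] | e in star S r])); last first.
    move=> A; apply: branching_one; last by apply/set0Pn; exists b.
    move=> e f; rewrite starE => /set2P[] -> /set2P[] -> //.
    - exact: same_branch_refl.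
    - by rewrite same_branch_sym.
    - exact: same_branch_refl.
  rewrite big_imset /=; last by move=> e f _ _; apply: set1_inj.
  rewrite (eq_bigr (fun=> 2)) => [|e _]; last by rewrite cards1.
  by rewrite sum_nat_const starE cards2 bc.
rewrite (eq_bigl (pred1 (star S r))) ?big_pred1_eq // => A.
apply: branching_all => e f eS fS ef; apply/eqP; apply: contraNT noPair => nef.
by apply/existsP; exists e; apply/existsP; exists f; rewrite eS fS nef.
Qed.

Lemma inside_setD1 S r : inside (S :\ r) = inside S :\: star S r.
Proof.
apply/setP=> e; rewrite !inE subsetD1.
by case: (ends e \subset S); rewrite ?andbF //= andbT.
Qed.

Lemma card_inside_setD1 S r : #|inside S| = #|inside (S :\ r)| + #|star S r|.
Proof.
rewrite inside_setD1 addnC -(cardsID (star S r) (inside S)) (setIidPr _) //.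
by apply/subsetP=> e; rewrite inE => /andP[].
Qed.

(** The completions of the partial tree [P] by edges inside [S]. *)
Definition trees S P : {set {set edge G}} :=
  [set T | `[< dfs_tree v0 T >] && (T :\: inside S == P)].

(** * Visiting one root: the new state and the recursion on the number of completions *)

Section Step.
Variables (S R : {set vertex G}) (P : {set edge G}) (r : vertex G).
Hypotheses (st : dfs_state v0 S P R) (rR : r \in R).

Let rS : r \in S. Proof. exact: (subsetP (st_roots st)). Qed.

Lemma new_root_props A e w : branching S r A -> e \in A -> joins e r w ->
  [/\ w \in S, w != r, linked S r w & w \notin reached S R].
Proof.
case/branchingP=> /subsetP AS _ _ /AS; exact: (star_other Gll st rR).
Qed.

Lemma reached_step A :
  reached (S :\ r) (R :\ r :|: new_roots r A) = reached S R :|: new_roots r A.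
Proof.
apply/setP=> x; rewrite !inE negb_and negbK.
by have [->|_] := eqVneq x r; rewrite /= ?rR ?orbT // orbA.
Qed.

(** The root [r] is replaced by one new root per chosen edge; these are distinct, and none was
    reached before. *)
Lemma card_roots_step A : branching S r A ->
  #|R :\ r :|: new_roots r A|.+1 = #|R| + #|A|.
Proof.
move=> br; rewrite cardsU (card_new_roots br) (cardsD1 r R) rR add1n addSn.
rewrite (_ : _ :&: _ = set0) ?cards0 ?subn0 //.
apply/setP=> x; rewrite in_set0; apply/negP=> /setIP[/setD1P[_ xR]].
have /branchingP[AS _ _] := br.
case/(new_rootsP _ AS)=> e eA erx; have [_ _ _] := new_root_props br eA erx.
by rewrite notin_reached xR andbF.
Qed.

Lemma ancestor_step A x e w : branching S r A -> e \in A -> joins e r w ->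
  ancestor v0 P x r \/ x = r -> ancestor v0 (P :|: A) x w.
Proof.
move=> br eA erw anc; have [_ _ _ wN] := new_root_props br eA erw.
have [p pP xp] : exists2 p, is_path P v0 p r & x \in v0 :: walk_vertices p.
  case: anc => [[p []]|->]; first by exists p.
  have [|p pP] := st_path st (_ : r \in reached S R); first by rewrite !inE rR orbT.
  by exists p => //; have /andP[/walk_last<- _] := pP; apply: mem_last.
have eP : e \in P :|: A by rewrite inE eA orbT.
exists (rcons p (e, w)); split.
  apply: is_path_rcons eP erw _.
    by case/andP: pP => pr up; rewrite /is_path up (walkS (subsetUl P A) pr).
  by have /andP[pr _] := pP; apply: contra wN => /(walk_reached st pr).
by rewrite -cats1 walk_vertices_cat -cat_cons mem_cat xp.
Qed.

(** Converse of [tree_branching]: each admissible choice can be pursued, so no branching is a dead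
    end. *)
Lemma state_step A : branching S r A ->
  dfs_state v0 (S :\ r) (P :|: A) (R :\ r :|: new_roots r A).
Proof.
move=> br; have /branchingP[AS ex un] := br; have rstep := reached_step A.
have newP w := new_rootsP w AS.
have SrS : S :\ r \subset S by apply: subD1set.
split.
- rewrite subUset setSD ?(st_roots st) //=; apply/subsetP=> w /newP[e eA erw].
  by have [wS wr _ _] := new_root_props br eA erw; rewrite !inE wr.
- by rewrite rstep inE (st_v0 st).
- move=> e; rewrite inside_setD1 !inE => /orP[/(st_outside st)|eA].
    by rewrite inE => /negPf->; rewrite andbF.
  by have := subsetP AS e eA; rewrite !inE => ->.
- move=> e x; rewrite rstep (in_setU e) (in_setU x (reached S R)).
  move=> /orP[eP|eA] xe; first by rewrite (st_ends st eP).
  have rw := joins_other_end (star_mem (subsetP AS e eA)).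
  move: xe; rewrite (joinsE _ rw) => /orP[] /eqP->; first by rewrite !inE rR orbT.
  by apply/orP; right; apply/newP; exists e.
- move=> u p; apply/negP=> pP; have /negP[] := st_acyclic st u p.
  (* Each chosen edge is pendant in [P :|: A]: its far end was not reached, and no other chosen edge
     enters that branch. A cycle would thus lie in [P]. *)
  have Np e : e \in A -> e \notin walk_edges p.
    move=> eA; have rw := joins_other_end (star_mem (subsetP AS e eA)).
    have eP : e \in P :|: A by rewrite inE eA orbT.
    apply: (cycle_avoid_leaf Gll eP (joinsr rw) _ pP) => f; rewrite inE.
    have [wS wr rlw wN] := new_root_props br eA rw.
    case/orP=> [fP wf|fA wf]; first by rewrite (st_ends st fP wf) in wN.
    apply: un => //; have fr := joins_other_end (star_mem (subsetP AS f fA)).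
    move: wf; rewrite (joinsE _ fr) (negPf wr) /= => /eqP wE.
    by rewrite (same_branch_joins _ fr rw) wE; apply: connect0.
  case/and4P: pP => p0 pu ue uv; rewrite /is_cycle p0 ue uv /= andbT.
  apply: (walk_restrict pu) => e ep; have := walk_edges_sub pu ep.
  by rewrite inE => /orP[//|/Np]; rewrite ep.
- move=> v; rewrite rstep in_setU => /orP[/(st_path st)[p /andP[pv up]]|/newP[e eA erw]].
    by exists p; rewrite /is_path up (walkS (subsetUl P A) pv).
  have [p [pP _]] := ancestor_step br eA erw (or_intror erefl).
  by exists p.
- move=> s /setD1P[sr sS]; have [r0 r0R r0s] := st_root_ex st sS.
  (* In the component of [r], the chosen edge into the branch of [s] supplies the root; any other
     component avoids [r] and keeps its root. *)
  have [rs|rs] := boolP (linked S r s).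
    have [f [c [fS frc cs]]] := linked_branch rs sS sr.
    have [e eA ef] := ex f fS; have rw := joins_other_end (star_mem (subsetP AS e eA)).
    exists (other_end r e); first by rewrite inE; apply/orP; right; apply/newP; exists e.
    by apply: linked_trans cs; rewrite -(same_branch_joins _ rw frc).
  exists r0; last exact: linked_avoid.
  by rewrite !inE r0R andbT (contraNneq _ rs) // => <-.
(* New roots lie in the old component of [r], whose only old root is [r]. *)
- have mixed r1 r2 : r1 \in R :\ r -> r2 \in new_roots r A -> ~~ linked (S :\ r) r1 r2.
    case/setD1P=> r1r r1R /newP[e eA er2]; apply: contra r1r => r12.
    have [_ _ rr2 _] := new_root_props br eA er2.
    rewrite (st_root_uniq st r1R rR) //; apply: linked_trans (linkedS SrS r12) _.
    by rewrite linked_sym.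
  move=> r1 r2; rewrite !(in_setU _ (R :\ r)) => /orP[r1R|r1A] /orP[r2R|r2A] r12.
  + by apply: (st_root_uniq st _ _ (linkedS SrS r12)); [case/setD1P: r1R | case/setD1P: r2R].
  + by move: (mixed _ _ r1R r2A); rewrite r12.
  + by move: (mixed _ _ r2R r1A); rewrite linked_sym r12.
  + have [[e eA er1] [f fA fr2]] := (newP _ r1A, newP _ r2A).
    have ef : e = f by apply: un => //; rewrite (same_branch_joins _ er1 fr2).
    by move: fr2; rewrite -ef; apply: joins_inj.
(* An edge whose ends have just become both visited has [r] as an end, and [st_ancestor] makes its
   other end an ancestor of [r]. *)
- move=> e u v; rewrite inE negb_or !in_setD1 !negb_and !negbK => /andP[eP _] euv.
  have sub := subsetUl P A.
  case/orP=> [/eqP ur|uS] /orP[/eqP vr|vS].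
  + by have := joins_neq Gll euv; rewrite ur vr eqxx.
  + right; apply: (ancestorS sub); rewrite ur in euv *.
    by apply: (st_ancestor st (e := e) (s := r)) => //; [rewrite joinsC | apply: connect0].
  + left; apply: (ancestorS sub); rewrite vr in euv *.
    by apply: (st_ancestor st (e := e) (s := r)) => //; apply: connect0.
  + exact: tree_comparableS sub (st_comparable st eP euv uS vS).
- move=> e x s r1 exs; rewrite in_setD1 negb_and negbK => xSr /setD1P[sr sS].
  rewrite in_setU => /orP[/setD1P[r1r r1R]|/newP[f fA fr1]] /(linkedS SrS) r1s.
    case/orP: xSr => [/eqP xr|xS]; last first.
      exact: ancestorS (subsetUl P A) (st_ancestor st exs xS sS r1R r1s).
    (* If [x = r], the edge puts [s] in the component of [r], so the old root [r1] would be [r]. *)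
    have rs : linked S s r.
      by rewrite linked_sym; apply: (@joins_linked _ _ e) => //; rewrite -xr.
    by rewrite (st_root_uniq st r1R rR (linked_trans r1s rs)) eqxx in r1r.
  apply: (ancestor_step br fA fr1); case/orP: xSr => [/eqP->|xS]; [by right | left].
  apply: (st_ancestor st exs xS sS rR); apply: linked_trans r1s.
  by have [] := new_root_props br fA fr1.
Qed.

(** Completions are sorted by their edges from [r] into [S]; [tree_branching] says that these always
    form a branching. *)
Lemma card_trees_step :
  #|trees S P| = \sum_(A | branching S r A) #|trees (S :\ r) (P :|: A)|.
Proof.
have starS : star S r \subset inside S by apply/subsetP=> e; rewrite inE => /andP[].
rewrite -sum1_card (partition_big (fun T => T :&: star S r) (branching S r)) /=.
  apply: eq_bigr => A /branchingP[AS _ _]; rewrite -sum1_card.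
  apply: eq_bigl => T; rewrite !(inE, in_set) -andbA; congr (_ && _).
  rewrite inside_setD1 setDDr; apply/andP/eqP=> [[/eqP-> /eqP->] //|TE].
  suff [-> ->] : T :\: inside S = P /\ T :&: star S r = A by rewrite !eqxx.
  apply: (@setU_inj _ (inside S)) TE; rewrite ?subDset ?setUS //.
  - by rewrite -setI_eq0 setDE -setIA (setIC (~: _)) setICr setI0.
  - by apply: subset_trans starS; apply: subsetIr.
  - by rewrite disjoint_subset; apply/subsetP=> e eP; apply: (st_outside st).
  - exact: subset_trans starS.
move=> T; rewrite inE => /andP[/asboolP dT /eqP TP].
exact: (tree_branching Gll st rR dT TP).
Qed.

(** The root is not [v0], so a tree edge attaches it; that edge is not inside [S], which leaves at
    most two of its three edges. *)
Lemma card_star_root :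
    v0 \notin S -> (forall v, v != v0 -> #|[set e | v \in ends e]| <= 3) ->
  #|star S r| <= 2.
Proof.
move=> v0S deg3; have rv0 : r != v0 by apply: contraNneq v0S => <-.
have [|p /andP[pr _]] := st_path st (_ : r \in reached S R); first by rewrite !inE rR orbT.
have rp : r \in walk_vertices p.
  have := mem_last v0 (walk_vertices p); rewrite (walk_last pr) inE.
  by rewrite (negPf rv0).
have [e eP re] := walk_vertex_edge pr rp.
have := deg3 r rv0; rewrite (cardsD1 e) inE re add1n ltnS; apply: leq_trans.
apply/subset_leq_card/subsetP=> f; rewrite !inE => /andP[fS ->]; rewrite andbT.
by apply: contraTneq fS => ->; have := st_outside st eP; rewrite inE.
Qed.

End Step.

(** * Solving the recursion, from the initial to the final state *)

Lemma inside_set0 : inside (@set0 (vertex G)) = set0.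
Proof.
apply/setP=> e; rewrite !inE subset0; apply/negbTE.
by rewrite -card_gt0 Gll.
Qed.

Lemma state_final P R : dfs_state v0 set0 P R -> dfs_tree v0 P.
Proof.
move=> st; have path v : exists p, walk P v0 p v.
  by have [|p /andP[]] := st_path st (_ : v \in reached set0 R); [rewrite !inE | exists p].
split; first split; last first.
- by move=> e u v eP euv; apply: (st_comparable st eP euv); rewrite inE.
- exact: st_acyclic st.
move=> u v _ _; have [[p pu] [q qv]] := (path u, path v).
have [p' p'v0 _] := walk_rev pu.
by exists (p' ++ q); rewrite walk_cat (walk_last p'v0) p'v0.
Qed.

(** As [R] has one vertex per component, the cyclomatic number on [S] is
    [#|inside S| - #|S| + #|R|]; the product form avoids the subtraction. *)
Lemma card_trees S P R :
    dfs_state v0 S P R -> v0 \notin S ->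
    (forall v, v != v0 -> #|[set e | v \in ends e]| <= 3) ->
  #|trees S P| * 2 ^ #|S| = 2 ^ (#|inside S| + #|R|).
Proof.
move=> + + deg3; have [m] := ubnP #|S|.
elim: m S P R => // m IH S P R; rewrite ltnS => leSm st v0S.
have [S0|[s sS]] := set_0Vmem S.
  have R0 : R = set0 by apply/eqP; rewrite -subset0 -S0 (st_roots st).
  rewrite S0 in st *; rewrite R0 inside_set0 !cards0 muln1 expn0.
  rewrite (_ : trees _ _ = [set P]) ?cards1 //; apply/setP=> T; rewrite !inE.
  rewrite inside_set0 setD0; case: (eqVneq T P) => [->|_]; rewrite ?andbF // andbT.
  by apply/asboolP; apply: state_final st.
have [r rR _] := st_root_ex st sS; have rS := subsetP (st_roots st) r rR.
rewrite (card_trees_step st rR) big_distrl /= (card_inside_setD1 S r) addnAC.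
(* The edges lost from [inside S] contribute the power of 2 that [sum_branching] expands, so the two
   sides can be compared one choice at a time. *)
rewrite expnD -(sum_branching (card_star_root st rR v0S deg3)) big_distrr /=.
apply: eq_bigr => A br; rewrite -expnD (cardsD1 r S) rS add1n expnS mulnCA.
rewrite (IH _ _ _ _ (state_step st rR br)) -?expnS.
- by rewrite -addnS (card_roots_step st rR br) addnA.
- by move: leSm; rewrite (cardsD1 r S) rS.
- by rewrite !inE negb_and v0S orbT.
Qed.

Lemma walk_linked S A u p v : A \subset inside S -> walk A u p v -> linked S u v.
Proof.
move=> /subsetP AS; elim: p u => [|[e w] p IH] u /=; first by move/eqP->; apply: connect0.
case/and3P=> /AS; rewrite inE => /subsetP eS euw /IH; apply: linked_trans.
by apply: (joins_linked _ _ euw); apply: eS; [apply: joinsl euw | apply: joinsr euw].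
Qed.

Lemma state_init : connected G -> dfs_state v0 setT set0 [set v0].
Proof.
move=> conn; split=> //.
- by rewrite !inE eqxx.
- by move=> e; rewrite inE.
- by move=> e x; rewrite inE.
- by move=> u [|[e w] p] //; rewrite /is_cycle /= inE.
- by move=> v; rewrite !inE => /eqP->; exists [::]; rewrite /is_path /= eqxx.
- move=> s _; exists v0; rewrite ?inE //.
  have [p ps] := conn v0 s (in_setT _) (in_setT _); apply: walk_linked ps.
  by apply/subsetP=> e _; rewrite inE subsetT.
- by move=> r r' /set1P-> /set1P->.
- by move=> e u v _ _; rewrite inE.
- by move=> e x s r _; rewrite in_setT.
Qed.

(** Double counting of incidences, each edge having two ends. *)
Lemma sum_degree : \sum_(v : vertex G) #|[set e | v \in ends e]| = 2 * #|edge G|.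
Proof.
under eq_bigr => v _ do rewrite -sum1dep_card big_mkcond.
rewrite exchange_big /= mulnC -sum_nat_const; apply: eq_bigr => e _.
by rewrite -(Gll e) -sum1_card [RHS]big_mkcond.
Qed.

End Count.

Theorem mainTheorem14 (G : multigraph) (v0 : vertex G) (e0 : edge G) (k n : nat)
    (Gloopless : loopless G) (Gconn : connected G)
    (Gv0 : connected_without v0) (e0v0 : v0 \in ends e0)
    (Gcubic : near_cubic v0 k) (Gsize : near_cubic_size G k n) :
  #|[set T : {set edge G} |
      `[< [/\ spanning_tree T, e0 \in T & externals_comparable v0 T] >] ]|
  = 2 ^ n.
Proof.
have degE (v : vertex G) : degree v = #|[set e | v \in ends e]|.
  rewrite /degree [X in _ + X](_ : _ = 0) ?addn0 //; apply: eq_card0 => e.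
  by rewrite inE; apply/eqP=> ev; have := Gloopless e; rewrite ev cards1.
have [degv0 deg3] := Gcubic.
have st0 := state_init v0 Gconn; have v0R := set11 v0.
have starE : star setT v0 = [set e | v0 \in ends e].
  by apply/setP=> e; rewrite !inE subsetT.
have e0S : e0 \in star setT v0 by rewrite starE inE.
(* All edges at [v0] lead into the single component of the graph without [v0], so a choice at [v0]
   is one edge. *)
have brE A : branching setT v0 A = (A \in [set [set e] | e in star setT v0]).
  apply: branching_one => [f g fS gS|]; last by apply/set0Pn; exists e0.
  have fr := joins_other_end Gloopless (star_mem fS).
  have gr := joins_other_end Gloopless (star_mem gS).
  rewrite (same_branch_joins _ fr gr).
  have [||p] := Gv0 (other_end v0 f) (other_end v0 g).
  - by rewrite !inE eq_sym (joins_neq Gloopless fr).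
  - by rewrite !inE eq_sym (joins_neq Gloopless gr).
  apply: walk_linked; apply/subsetP=> h; rewrite !inE => hv0.
  by rewrite subsetD1 subsetT.
have br0 : branching setT v0 [set e0] by rewrite brE imset_f.
have st1 := state_step Gloopless st0 v0R br0.
have deg3' v : v != v0 -> #|[set e | v \in ends e]| <= 3.
  by move=> vv0; rewrite -degE deg3.
have v0N : v0 \notin setT :\ v0 by rewrite !inE eqxx.
have := card_trees Gloopless st1 v0N deg3'.
set D := trees _ _ _; set W := [set T | _].
have -> : D = W.
  apply/setP=> T; rewrite !inE set0U; apply/andP/asboolP.
    case=> /asboolP[sT cT] /eqP TE; split=> //.
    have : e0 \in [set e0] by rewrite inE.
    by rewrite -TE => /setDP[].
  case=> sT e0T cT; have dT : dfs_tree v0 T by [].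
  split; first exact/asboolP.
  have TP : T :\: inside setT = set0.
    by apply/setP=> e; rewrite !inE subsetT.
  (* The tree has a single edge at [v0]; since it contains [e0], that edge is [e0]. *)
  have := tree_branching Gloopless st0 v0R dT TP; rewrite brE => /imsetP[f _ Tf].
  rewrite inside_setD1 setDDr TP set0U Tf.
  by have : e0 \in [set f]; [rewrite -Tf inE e0T | move/set1P->].
have cE : #|edge G| = #|inside (setT :\ v0)| + k.
  rewrite -degv0 degE -starE -card_inside_setD1 -cardsT; congr #|pred_of_set _|.
  by apply/setP=> e; rewrite !inE subsetT.
have cR := card_roots_step Gloopless st0 v0R br0; rewrite !cards1 in cR.
have cV : #|vertex G| = #|[set: vertex G] :\ v0|.+1.
  by rewrite -cardsT (cardsD1 v0) inE.
have := sum_degree Gloopless; rewrite (bigD1 v0) //= -degE degv0.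
rewrite (eq_bigr (fun=> 3)) => [|v vv0]; last by rewrite -degE deg3.
rewrite sum_nat_const cardC1 cV /= => handshake.
(* By [cR] one root remains, so with E edges and V vertices the exponent is E - k + 1. Three times
   it is (E + 3 - 2k) + (2E - k), that is 3n + 3(V - 1) by the size and the handshake identity. *)
rewrite (_ : _ + _ = n + #|[set: vertex G] :\ v0|); last first.
  move: Gsize cE cR handshake; rewrite /near_cubic_size.
  move: #|edge G| #|inside _| #|_ :|: _| #|_ :\ _| => a b c d.
  lia.
by rewrite expnD => /eqP; rewrite eqn_pmul2r ?expn_gt0 // => /eqP.
Qed.
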